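(* Let $q\geq 2$ be an integer and let $\alpha$ be an irrational real number with $0<\alpha<1$. Then \[ \liminf_{n\to\infty}\frac{s_q(\lfloor n^{\alpha}\rfloor)}{s_q(n)}=0. \]
   Context: For an integer $q\geq 2$ and $n\in\mathbb{N}$, $s_q(n)$ denotes the sum of the digits of $n$ written in base $q$. $\lfloor x\rfloor$ is the floor of $x$. *)

(* Defs.v *)
From mathcomp Require Import all_boot.

Set Implicit Arguments.
Unset Strict Implicit.
Unset Printing Implicit Defensive.

(* For 1 < q and 0 < n, trunc_log q n is the position of the leading base-q
   digit of n, and n %/ q ^ i %% q is the digit at position i.
   Since trunc_log q 0 = 0, the digit sum of 0 is 0. *)
Definition digit_sum (q n : nat) : nat :=
  \sum_(0 <= i < (trunc_log q n).+1) (n %/ q ^ i) %% q.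

(* Main.v *)
Require Import Defs.
From mathcomp Require Import all_boot all_order all_algebra.
From mathcomp Require Import all_classical all_reals all_analysis.
From mathcomp Require Import zify ring lra.

Set Implicit Arguments.
Unset Strict Implicit.
Unset Printing Implicit Defensive.

Import Order.TTheory GRing.Theory Num.Theory.
Import numFieldNormedType.Exports.

Local Open Scope ring_scope.

(** Take [n] with [floor (n ^ alpha) = q ^ k], a number of digit sum 1. These
    [n] fill an interval starting at [q ^ (k / alpha)], whose length tends to
    infinity with [k] because [1 / alpha > 1]. For fixed [m] and large [k] it
    therefore contains a number congruent to [-1] modulo [q ^ m]; such a number
    has digit sum at least [m], and the ratio is then at most [1 / m]. *)

Lemma digit_sum_expn (q k : nat) : (1 < q)%N -> digit_sum q (q ^ k) = 1%N.
Proof.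
move=> q1; rewrite /digit_sum trunc_expnK // big_nat_recr //=.
rewrite divnn expn_gt0 (ltnW q1) modn_small // big_nat big1 ?add0n // => i /andP[_ ik].
rewrite -expnB; [|exact: ltnW|exact: ltnW].
by apply/eqP; apply: dvdn_exp => //; rewrite subn_gt0.
Qed.

(** The [m] lowest digits are all [q - 1], so each contributes at least 1. *)
Lemma leq_digit_sum_predn_muln_expn (q m c : nat) : (1 < q)%N -> (1 < c)%N ->
  (m <= digit_sum q (c * q ^ m).-1)%N.
Proof.
move=> q1 c1; have qX i : (0 < q ^ i)%N by rewrite expn_gt0 ltnW.
have mlog : (m <= (trunc_log q (c * q ^ m).-1).+1)%N.
  apply: leqW; apply: trunc_log_max => //.
  by have := qX m; nia.
rewrite /digit_sum (big_cat_nat (leq0n m) mlog) /=; apply: leq_trans (leq_addr _ _).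
rewrite -[X in (X <= _)%N]muln1 -[X in (X * _)%N]subn0 -sum_nat_const_nat.
rewrite !big_nat; apply: leq_sum => i /andP[_ im].
(* Division by [q ^ i] thus leaves [c * q ^ (m - i) - 1], which is [-1] modulo [q] because
   [i < m]. *)
have -> : (c * q ^ m).-1 = ((c * q ^ (m - i)).-1 * q ^ i + (q ^ i).-1)%N.
  rewrite -[in LHS](subnK (ltnW im)) expnD mulnA.
  by have := qX i; have := qX (m - i)%N; nia.
rewrite divnMDl // divn_small ?prednK // addn0.
have -> : (m - i = (m - i.+1).+1)%N by rewrite subnSK.
have -> : (c * q ^ (m - i.+1).+1).-1 =
          ((c * q ^ (m - i.+1)).-1 * q + q.-1)%N.
  by rewrite expnSr mulnA; have := qX (m - i.+1)%N; nia.
by rewrite modnMDl modn_small; lia.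
Qed.

(** Factor [a + h = a * (1 + h / a)]: a base at least 1 does not grow under an exponent at most 1,
    so the increment of the power is at most [a ^ alpha * h / a], which the last hypothesis bounds
    by 1. *)
Lemma powR_lt_add1 (R : realType) (alpha x h a : R) : 0 < alpha <= 1 ->
  0 < a -> 0 <= x -> 0 <= h -> x < a + h -> h * a `^ alpha <= a ->
  x `^ alpha < a `^ alpha + 1.
Proof.
move=> /andP[al0 al1] a0 x0 h0 xah ha.
have ha0 : 0 <= h / a by rewrite divr_ge0 // ltW.
have : x `^ alpha < (a + h) `^ alpha.
  by apply: gt0_ltr_powR => //; rewrite nnegrE //; lra.
move=> /lt_le_trans; apply.
have -> : a + h = a * (1 + h / a) by field; lra.
rewrite powRM; [|lra|lra].
have b1 : (1 + h / a) `^ alpha <= 1 + h / a by apply: ler1_powR => //; lra.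
apply: le_trans (ler_wpM2l (powR_ge0 _ _) b1) _.
by rewrite mulrDr mulr1 lerD2l mulrA ler_pdivrMr // mul1r mulrC.
Qed.

Lemma exists_truncn_powR_eq_expn (R : realType) (q : nat) (alpha : R)
    (m K : nat) : (1 < q)%N -> 0 < alpha < 1 ->
  exists k c : nat, [/\ (1 < c)%N, (K <= (c * q ^ m).-1)%N &
    Num.truncn ((c * q ^ m).-1%:R `^ alpha) = (q ^ k)%N].
Proof.
move=> q1 /andP[al0 al1].
have q1R : 1 < q%:R :> R by rewrite ltr1n.
(* With [X = q ^ k] and [a = X ^ (1 / alpha)], the quotient [a / X] is [q ^ (k * delta)]. Taking
   [k * delta >= m + 1] makes it at least [2 * q ^ m], and [k >= K] will give
   [n >= a >= q ^ k > K]. *)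
pose delta := alpha^-1 - 1.
have delta0 : 0 < delta by rewrite subr_gt0 invf_gt1.
pose k := maxn K (Num.truncn (m.+1%:R / delta)).+1.
have kdelta : m.+1%:R <= k%:R * delta.
  rewrite -ler_pdivrMr //; apply/ltW/(lt_le_trans (truncnS_gt _)).
  by rewrite ler_nat leq_maxr.
pose X : R := q%:R ^+ k.
have X1 : 1 <= X by apply: exprn_ege1; exact: ltW.
pose a := X `^ alpha^-1.
have aX : a = X * q%:R `^ (k%:R * delta).
  rewrite /a /X -powR_mulrn ?ler0n // -powRrM -powRD; last first.
    by apply/implyP => _; rewrite gt_eqF //; lra.
  by congr (_ `^ _); rewrite /delta; ring.
have aal : a `^ alpha = X.
  by rewrite -powRrM mulVf ?gt_eqF // powRr1 //; lra.
pose Q : R := q%:R ^+ m.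
have Q1 : 1 <= Q by apply: exprn_ege1; exact: ltW.
have ha : 2 * Q * X <= a.
  rewrite aX mulrC ler_pM2l; last lra.
  apply: le_trans (_ : q%:R `^ m.+1%:R <= _); last by apply: ler_powR => //; lra.
  rewrite powR_mulrn ?ler0n // exprS ler_pM2r; last by rewrite /Q in Q1 *; lra.
  by rewrite ler_nat.
have Xa : X <= a by nra.
(* The offset 2 gives [(c - 1) * Q > a], so that [c * Q - 1] is still at least [a] as [Q >= 1],
   while [c * Q <= a + 2 * Q]. *)
pose c := (Num.truncn (a / Q)).+2.
have cQ : (c * q ^ m)%:R = c%:R * Q :> R by rewrite natrM natrX.
have cgt0 : (0 < c * q ^ m)%N by rewrite muln_gt0 /= expn_gt0 ltnW.
pose n := (c * q ^ m).-1.
have nE : n%:R = c%:R * Q - 1 :> R.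
  by rewrite -cQ -[in RHS](prednK cgt0) -[X in X%:R - 1]addn1 natrD addrK.
have /andP[tl tg] := truncn_itv (divr_ge0 (le_trans ler01 (le_trans X1 Xa))
  (le_trans ler01 Q1)).
rewrite ler_pdivlMr in tl; last lra.
rewrite ltr_pdivrMr in tg; last lra.
set t := Num.truncn (a / Q) in tl tg *.
have cE : c%:R = t%:R + 2 :> R by rewrite /c -addn2 natrD.
have tE : t.+1%:R = t%:R + 1 :> R by rewrite -addn1 natrD.
rewrite tE in tg.
have an : a <= n%:R by rewrite nE cE; nra.
have na : n%:R < a + 2 * Q by rewrite nE cE; nra.
exists k, c; split => //.
  rewrite -/n; apply: leq_trans (_ : k <= _)%N; first exact: leq_maxl.
  apply: leq_trans (ltnW (ltn_expl k q1)) _.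
  by rewrite -(ler_nat R) natrX -/X; lra.
apply: truncn_def; rewrite -/n -addn1 natrD natrX -/X -aal; apply/andP; split.
  by apply: ge0_ler_powR; rewrite ?nnegrE //; lra.
by apply: (@powR_lt_add1 _ _ _ (2 * Q)); rewrite ?aal //; lra.
Qed.

(** The lower limit is the supremum of the tail infima, and each of these is 0. *)
Lemma limn_einf_eq0 (R : realType) (u : nat -> R) : (forall n, 0 <= u n) ->
  (forall e, 0 < e -> forall K, exists2 n, (K <= n)%N & u n <= e) ->
  limn_einf (fun n => (u n)%:E) = 0%:E.
Proof.
move=> u0 usmall.
rewrite limn_einf_lim (cvg_lim _ (@cvg_einfs_sup _ _)) //.
have inf0 K : einfs (fun n => (u n)%:E) K = 0%:E.
  apply/eqP; rewrite eq_le; apply/andP; split.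
    apply/lee_addgt0Pr => e e0; have [n Kn un] := usmall e e0 K.
    apply: (@le_trans _ _ (u n)%:E); last by rewrite add0e lee_fin.
    by apply: ereal_inf_lbound; exists n.
  by apply: le_ereal_inf_tmp => _ [n _ <-]; rewrite lee_fin.
rewrite (_ : range _ = [set 0%:E])%classic ?ereal_sup1 //.
by apply/seteqP; split=> [_ [K _ <-]|_ ->] /=; [rewrite inf0|exists 0%N].
Qed.

Theorem theorem4p3 (R : realType) (q : nat) (hq : (2 <= q)%N)
    (alpha : R) (halpha_irr : irrational alpha) (halpha : 0 < alpha < 1) :
  limn_einf (fun n : nat =>
    ((digit_sum q (Num.truncn (n%:R `^ alpha)))%:R
       / (digit_sum q n)%:R : R)%:E)
  = 0%:E.
Proof.
(* At [n = 0] the denominator is 0 and the quotient is 0 by convention, so nonnegativity holds there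
   too. *)
apply: limn_einf_eq0 => [n|e e0 K]; first by rewrite divr_ge0.
pose m := (Num.truncn e^-1).+1.
have [k [c [c1 Kn nk]]] := @exists_truncn_powR_eq_expn R q alpha m K hq halpha.
exists (c * q ^ m).-1 => //.
have em : e^-1 < m%:R := truncnS_gt _.
have := leq_digit_sum_predn_muln_expn m hq c1.
rewrite -(ler_nat R) => ms.
have e10 : 0 < e^-1 by rewrite invr_gt0.
rewrite nk digit_sum_expn // mul1r -[leRHS]invrK lef_pV2 ?posrE //; lra.
Qed.
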